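(* Let $\gamma=\gamma(\nu_3)$ be any axially symmetric anisotropic energy density. Then for all $\lambda, C\in\mathbf{R}$ the helicoid $z=\lambda\theta+C$, where $(r,\theta,z)$ are cylindrical coordinates on $\mathbf{R}^3$ (that is, the surface $X(r,\theta)=(r\cos\theta,\,r\sin\theta,\,\lambda\theta+C)$), has anisotropic mean curvature $\Lambda\equiv 0$ with respect to $\gamma$.
   Context: An anisotropic energy density is a smooth function $\gamma:S^2\to\mathbf{R}$; it defines the functional $\mathcal{F}=\int_\Sigma\gamma(\nu)\,d\Sigma$ on smooth oriented immersed surfaces $X:\Sigma\to\mathbf{R}^3$ with unit normal (Gauss map) $\nu=(\nu_1,\nu_2,\nu_3)$. Its Wulff shape is $W=\partial\bigcap_{n\in S^2}\{Y\in\mathbf{R}^3: Y\cdot n\le\gamma(n)\}$. It is assumed throughout that $W$ is a smooth convex surface with positive curvature, and that $\gamma$ is its support function. The density is axially symmetric if $\gamma$ depends only on $\nu_3$, written $\gamma=\gamma(\nu_3)$. Let $\tilde\gamma(Y)=|Y|\gamma(Y/|Y|)$, $Y\ne 0$, be the degree one positively homogeneous extension of $\gamma$. The Cahn-Hoffman field of an oriented surface with normal $\nu$ is $\xi_p=(\nabla\tilde\gamma)_{\nu(p)}$, and the anisotropic mean curvature is $\Lambda=-\mathrm{Div}\,\xi$, where $\mathrm{Div}$ is the surface divergence on $\Sigma$ (the trace over the tangent plane of the differential of $\xi$). Equivalently, $\delta\mathcal{F}=-\int_\Sigma\Lambda\,\dot X\cdot\nu\,d\Sigma$ for compactly supported variations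 $\dot X$. *)

(* Defs.v *)
From HB Require Import structures.
From mathcomp Require Import all_boot all_order all_algebra.
From mathcomp Require Import all_classical all_reals all_analysis.

Set Implicit Arguments.
Unset Strict Implicit.
Unset Printing Implicit Defensive.

Import Order.TTheory GRing.Theory Num.Theory.
Import numFieldNormedType.Exports.

Local Open Scope classical_set_scope.
Local Open Scope ring_scope.

(* Vectors of R^n are rows. The library norm `|x| on 'rV[R]_n is the sup norm;
   it is only used through the topology it induces, the Euclidean norm being
   [enorm]. Jacobians are transposed accordingly: row i of ['J X u] is the
   partial derivative of X along the i-th coordinate. *)

Section Euclidean.
Variables (R : realType) (n : nat).
Implicit Types u v : 'rV[R]_n.

Definition dot u v : R := \sum_(i < n) u 0 i * v 0 i.

Definition enorm u : R := Num.sqrt (dot u u).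

Definition basis_vec (i : 'I_n) : 'rV[R]_n := delta_mx 0 i.

End Euclidean.

Section Smooth.
Variables (R : realType) (V W : normedModType R).

(* On an open set in finite dimension this is C^k: f is C^(k+1) iff it is
   differentiable and all its directional derivatives are C^k. *)
Fixpoint Ck (k : nat) (U : set V) (f : V -> W) : Prop :=
  match k with
  | 0 => forall x, U x -> {for x, continuous f}
  | k'.+1 => (forall x, U x -> differentiable f x) /\
             (forall v : V, Ck k' U ('D_v f))
  end.

Definition smooth_on (U : set V) (f : V -> W) : Prop := forall k, Ck k U f.

End Smooth.

Section Surfaces.
Variable R : realType.
Local Notation plane := 'rV[R]_2.
Local Notation space := 'rV[R]_3.
Implicit Types (U : set plane) (X nu : plane -> space) (S : set space).

Definition immersed_surface U X : Prop :=
  [/\ open U, smooth_on U X & forall u, U u -> row_free ('J X u)].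

Definition unit_normal X (u : plane) (n : space) : Prop :=
  enorm n = 1 /\ forall i : 'I_2, dot (row i ('J X u)) n = 0.

(* An orientation: a continuous choice of one of the two unit normals. *)
Definition gauss_map U X nu : Prop :=
  forall u, U u -> unit_normal X u (nu u) /\ {for u, continuous nu}.

Definition first_form X (u : plane) : 'M[R]_2 := 'J X u *m ('J X u)^T.

Definition second_form X (u : plane) (n : space) : 'M[R]_2 :=
  \matrix_(i, j) dot ('D_(basis_vec R j) ('D_(basis_vec R i) X) u) n.

Definition gauss_curvature X (u : plane) (n : space) : R :=
  \det (second_form X u n) / \det (first_form X u).

(* The last condition says that X is open, hence a homeomorphism, from U onto
   its image with the topology induced by S. *)
Definition local_parametrization S U X : Prop :=
  [/\ immersed_surface U X,
      set_inj U X
    & forall U', open U' -> U' `<=` U ->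
        exists2 V : set space, open V & X @` U' = S `&` V].

Definition smooth_surface S : Prop :=
  forall p, S p -> exists U X, local_parametrization S U X /\ (X @` U) p.

Definition positive_curvature S : Prop :=
  forall U X u n, local_parametrization S U X -> U u -> unit_normal X u n ->
    0 < gauss_curvature X u n.

Definition boundary S : set space := closure S `\` S°.

Definition convex_surface S : Prop :=
  exists K : set space,
    [/\ convex_set K, compact K, K° !=set0 & S = boundary K].

(* If aJ is the tangent vector with coordinates a in the frame given by the rows
   of J = 'J X u, then dxi maps it to a('J xi u), whose tangential part bJ is
   determined by b(JJ^T) = a('J xi u)J^T. The matrix below is thus that of the
   tangential part of dxi, viewed as an endomorphism of the tangent plane. *)
Definition surface_div X (xi : plane -> space) (u : plane) : R :=
  \tr ('J xi u *m ('J X u)^T *m invmx (first_form X u)).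

End Surfaces.

Section Anisotropy.
Variable R : realType.
Local Notation plane := 'rV[R]_2.
Local Notation space := 'rV[R]_3.

(* Only the values of gamma on the unit sphere are ever used. *)
Implicit Types gamma : space -> R.

Definition sphere : set space := [set n | enorm n = 1].

Definition smooth_on_sphere gamma : Prop :=
  forall n, sphere n -> exists V F,
    [/\ open V, V n, smooth_on V F & forall m, V m -> sphere m -> F m = gamma m].

Definition wulff_body gamma : set space :=
  [set Y | forall n, sphere n -> dot Y n <= gamma n].

Definition wulff_shape gamma : set space := boundary (wulff_body gamma).

Definition support_function S gamma : Prop :=
  forall n, sphere n -> gamma n = sup [set dot Y n | Y in S].

Definition anisotropic_energy_density gamma : Prop :=
  [/\ smooth_on_sphere gamma,
      smooth_surface (wulff_shape gamma),
      convex_surface (wulff_shape gamma),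
      positive_curvature (wulff_shape gamma)
    & support_function (wulff_shape gamma) gamma].

Definition axially_symmetric gamma : Prop :=
  exists g : R -> R, forall n, sphere n -> gamma n = g (n 0 ord_max).

Definition homogeneous_ext gamma (Y : space) : R :=
  enorm Y * gamma ((enorm Y)^-1 *: Y).

Definition grad (F : space -> R) (Y : space) : space :=
  \row_(i < 3) 'D_(basis_vec R i) F Y.

Definition cahn_hoffman gamma (nu : plane -> space) (u : plane) : space :=
  grad (homogeneous_ext gamma) (nu u).

Definition aniso_mean_curvature gamma (X nu : plane -> space) (u : plane) : R :=
  - surface_div X (cahn_hoffman gamma nu) u.

Definition vec3 (x y z : R) : space := \row_(i < 3) [:: x; y; z]`_i.

(* The coordinates of u are (r, theta), with r of any sign. *)
Definition helicoid (lambda C : R) (u : plane) : space :=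
  let r := u 0 0 in let theta := u 0 1 in
  vec3 (r * cos theta) (r * sin theta) (lambda * theta + C).

End Anisotropy.

(* Main.v *)
From HB Require Import structures.
Require Import Defs.
From mathcomp Require Import all_boot all_order all_algebra.
From mathcomp Require Import all_classical all_reals all_analysis.
From mathcomp Require Import ring.

Set Implicit Arguments.
Unset Strict Implicit.
Unset Printing Implicit Defensive.

Import Order.TTheory GRing.Theory Num.Theory.
Import numFieldNormedType.Exports.

Local Open Scope classical_set_scope.
Local Open Scope ring_scope.

(** Write [gamma n = g n_3]. Away from the poles the Cahn-Hoffman map is
    [n |-> (g s - s g' s) n + g' s e_3] with [s = n_3] (grad_homogeneous_ext), where
    [g] is twice differentiable (axial_profile_derivable2).

    For [lambda != 0] the helicoid satisfies [x sin phi - y cos phi = 0] with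
    [phi = (z - C) / lambda]. Let [D = (cos phi, sin phi, 0)] be the direction of the
    horizontal ruling through a point, [T = (sin phi, - cos phi, 0)], and [t] the
    signed distance to the axis divided by [lambda]. The gradient of the equation is
    [T + t e_3], so the normal of any immersed piece is locally [T + t e_3]
    normalized, up to a fixed sign (level_set_normal, gauss_map_near_unit). Hence the
    Cahn-Hoffman field is [Xi = a(t) T + b(t) e_3] for functions [a], [b] of [t] alone
    (cahn_hoffman_helicoid_field).

    This formula defines [Xi] on all of space, and the surface divergence is
    [tr dXi - <dXi n, n>] (surface_div_ambient). On the helicoid [dt = <D, .> / lambda]
    and [dT = D dz / lambda], so
    [dXi = (<D, .> (a' T + b' e_3) + a dz D) / lambda].
    Its trace vanishes because [D] is orthogonal to [T] and [e_3]; and it sends the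
    normal, which is orthogonal to [D], to a multiple of [D], so the second term
    vanishes too.

    In geometric terms, with [v] the tangential part of [e_3] and [II] the second
    fundamental form, the divergence combines the mean curvature and [II(v, v)]. The
    helicoid is minimal, so as its rulings are asymptotic lines the direction
    orthogonal to them is asymptotic too; the rulings being horizontal, that is the
    direction of [v]. *)

(** * Differentials *)

Section Differentials.
Variable R : realType.

(** A differential only depends on the germ of the function; this is what allows
    local normal forms of the Gauss map and of [gamma] to be differentiated. *)
Lemma near_eq_is_diff (V W : normedModType R) (f g df : V -> W) x :
  {near x, f =1 g} -> is_diff x f df -> is_diff x g df.
Proof.
move=> fg [f_diff dfE].
have [df_cont f_expand] := (diff_locallyP _ _).1 f_diff.
have g_expand : g \o shift x = cst (g x) + 'd f x +o_ 0 id.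
  apply/eqaddoP => eps eps0.
  have /eqaddoP /(_ _ eps0) := f_expand; apply: filter_app.
  have : \forall h \near (0 : V), f (h + x) = g (h + x).
    by rewrite (near_shift x) /=; near do rewrite /= sub0r subrK.
  by apply: filter_app; near=> h => fgh;
    rewrite /cst/= !fctE/= fgh (nbhs_singleton fg).
have dgE : 'd g x = 'd f x :> (V -> W) by exact: diff_unique.
apply: DiffDef; last by rewrite dgE.
by apply/diff_locallyP; rewrite dgE.
Unshelve. all: by end_near. Qed.

Lemma is_diff_comp1 (V W : normedModType R) (f df : V -> R) (g : R -> W) a x :
  is_diff x f df -> is_derive (f x) 1 g a ->
  is_diff x (g \o f) (fun h => df h *: a).
Proof.
move=> fdf [g_der ga].
have g_diff : differentiable g (f x) by exact/derivable1_diffP.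
have gdg : is_diff (f x) g ( *:%R ^~ a).
  by apply: DiffDef => //; rewrite diff1E // derive1E ga.
exact: is_diff_comp.
Qed.

(** Lets a map into space be differentiated one coordinate at a time. *)
Lemma is_diff_vec3 (V : normedModType R) (f1 f2 f3 d1 d2 d3 : V -> R) x :
  is_diff x f1 d1 -> is_diff x f2 d2 -> is_diff x f3 d3 ->
  is_diff x (fun u => vec3 (f1 u) (f2 u) (f3 u))
            (fun h => vec3 (d1 h) (d2 h) (d3 h)).
Proof.
have vec3E a b c : vec3 a b c = a *: vec3 1 0 0 + b *: vec3 0 1 0
    + c *: vec3 0 0 1 :> 'rV[R]_3.
  apply/rowP => i; rewrite !mxE.
  by case: i => -[|[|[|//]]] ? /=; rewrite ?(mulr0, mulr1, addr0, add0r).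
move=> fd1 fd2 fd3.
have Z (f d : V -> R) w : is_diff x f d ->
    is_diff x (fun u => f u *: w : 'rV[R]_3) (fun h => d h *: w).
  case=> f_diff dE; apply: DiffDef; first exact: differentiableZl.
  by rewrite diffZl // dE.
under [X in is_diff _ X _]funext => u do rewrite vec3E.
under [X in is_diff _ _ X]funext => u do rewrite vec3E.
exact: (is_diffD (is_diffD (Z _ _ _ fd1) (Z _ _ _ fd2)) (Z _ _ _ fd3)).
Qed.

Lemma is_diff_coord n (x : 'rV[R]_n) (i : 'I_n) :
  is_diff x (fun y : 'rV[R]_n => y 0 i : R) (fun h => h 0 i).
Proof.
have f_lin : linear (fun y : 'rV[R]_n => y 0 i : R).
  by move=> a u v; rewrite !mxE.
pose f_linM := GRing.isLinear.Build _ _ _ _ _ f_lin.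
pose f : {linear 'rV[R]_n -> R} := HB.pack (fun y : 'rV[R]_n => y 0 i : R) f_linM.
have f_cont : continuous f by exact: coord_continuous.
split; [exact: (@linear_differentiable _ _ _ f)|exact: (@diff_lin _ _ _ f)].
Qed.

Lemma jacobian_row m n (f : 'rV[R]_m -> 'rV[R]_n) df x i :
  is_diff x f df -> row i ('J f x) = df (basis_vec R i).
Proof. by case=> _ <-; rewrite rowE /basis_vec /jacobian mul_rV_lin1. Qed.

Lemma jacobian_is_diff m n p (f : 'rV[R]_m -> 'rV[R]_n) (g : 'rV[R]_m -> 'rV[R]_p) x
    (M : 'M[R]_(n, p)) : is_diff x g (fun h => 'd f x h *m M) ->
  'J g x = 'J f x *m M.
Proof.
by case=> _ dg; apply/row_matrixP => i; rewrite !rowE /jacobian mulmxA !mul_rV_lin1/= dg.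
Qed.

Lemma jacobian_near_cst m n (f : 'rV[R]_m -> 'rV[R]_n) x y :
  (\forall z \near x, f z = y) -> 'J f x = 0.
Proof.
move=> fy.
have y_f : {near x, cst y =1 f} by apply: filterS fy => z /= ->.
have df := near_eq_is_diff y_f (is_diff_cst y x).
by apply/row_matrixP => i; rewrite (jacobian_row _ df) row0.
Qed.

Lemma derivable_comp1 (f g : R -> R) x :
  derivable g x 1 -> derivable f (g x) 1 -> derivable (f \o g) x 1.
Proof.
move=> /derivable1_diffP dg /derivable1_diffP df; apply/derivable1_diffP.
exact: differentiable_comp.
Qed.

End Differentials.

(** * Tangent planes and the surface divergence *)

Section TangentPlane.
Variable R : realType.
Implicit Types (n u v : 'rV[R]_3) (J : 'M[R]_(2, 3)).

Lemma dotE m (u v : 'rV[R]_m) : dot u v = (u *m v^T) 0 0.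
Proof. by rewrite mxE; apply: eq_bigr => i _; rewrite mxE. Qed.

Lemma dotC m (u v : 'rV[R]_m) : dot u v = dot v u.
Proof. by apply: eq_bigr => i _; rewrite mulrC. Qed.

Lemma dotZl m a (u v : 'rV[R]_m) : dot (a *: u) v = a * dot u v.
Proof. by rewrite !dotE -scalemxAl mxE. Qed.

Lemma dotZr m a (u v : 'rV[R]_m) : dot u (a *: v) = a * dot u v.
Proof. by rewrite dotC dotZl dotC. Qed.

Lemma dot3 u v : dot u v = u 0 0 * v 0 0 + u 0 1 * v 0 1 + u 0 ord_max * v 0 ord_max.
Proof.
rewrite /dot !big_ord_recl big_ord0 addr0 addrA.
by do ![congr (_ + _)|congr (_ * _)|congr (fun_of_matrix _ _ _)|apply/val_inj].
Qed.

Lemma dot_ge0 m (u : 'rV[R]_m) : 0 <= dot u u.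
Proof. by apply: sumr_ge0 => i _; rewrite -expr2 sqr_ge0. Qed.

Lemma dot_eq0 m (u : 'rV[R]_m) : (dot u u == 0) = (u == 0).
Proof.
apply/eqP/eqP => [u0|->]; last by rewrite /dot big1 // => i _; rewrite mxE mul0r.
apply/rowP => i; rewrite mxE; apply/eqP; rewrite -sqrf_eq0 expr2.
by move/psumr_eq0P : u0 => -> // j _; rewrite -expr2 sqr_ge0.
Qed.

Lemma enorm_sqr m (u : 'rV[R]_m) : enorm u ^+ 2 = dot u u.
Proof. by rewrite sqr_sqrtr // dot_ge0. Qed.

(** A vector [k] killed by [J *m J^T] satisfies [|k J|^2 = k J J^T k^T = 0]. *)
Lemma gram_unit m p (J : 'M[R]_(m, p)) : row_free J -> J *m J^T \in unitmx.
Proof.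
move=> J_free; rewrite -row_free_unit -kermx_eq0; apply/eqP/row_matrixP => i.
rewrite row0; set k := row i _.
have : k *m (J *m J^T) = 0 by apply/sub_kermxP; rewrite row_sub.
move=> /(congr1 (mulmx^~ k^T)); rewrite mul0mx mulmxA -mulmxA -trmx_mul.
move=> /matrixP/(_ 0 0); rewrite -dotE mxE => /eqP; rewrite dot_eq0 => /eqP.
by rewrite -(mul0mx _ J) => /row_free_inj; apply.
Qed.

(** The left-hand side is the orthogonal projection onto the row space of [J].
    Stacking [J] on [n] gives an invertible [K] with [K (P + n^T n) = K], whence
    [P + n^T n = 1]. *)
Lemma tangent_projection J n : row_free J -> J *m n^T = 0 -> dot n n = 1 ->
  J^T *m invmx (J *m J^T) *m J = 1%:M - n^T *m n.
Proof.
move=> J_free Jn nn.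
have G_unit := gram_unit J_free.
set P := _ *m J; apply/eqP; rewrite eq_sym subr_eq eq_sym; apply/eqP.
(* The row type [2 + 1] keeps the block structure visible; it converts to 3. *)
pose K := col_mx J n : 'M[R]_(2 + 1, 3).
have KKt : K *m K^T = block_mx (J *m J^T) 0 0 1%:M :> 'M[R]_(2 + 1).
  rewrite /K tr_col_mx mul_col_row Jn; congr block_mx.
    by rewrite -[n *m _]trmxK trmx_mul trmxK Jn trmx0.
  by apply/matrixP => i j; rewrite !ord1 -dotE nn mxE.
have KKt_unit : K *m K^T \in unitmx.
  by rewrite KKt unitmxE det_ublock det1 mulr1 -unitmxE.
have K_unit : (K : 'M[R]_3) \in unitmx.
  by have : (K : 'M[R]_3) *m (K^T : 'M[R]_3) \in unitmx := KKt_unit;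
    rewrite unitmx_mul => /andP[].
have nJt : n *m J^T = 0 by rewrite -[n *m _]trmxK trmx_mul trmxK Jn trmx0.
have nnt : n *m n^T = 1%:M.
  by apply/matrixP => i j; rewrite !ord1 -dotE nn mxE.
have KP : K *m (P + n^T *m n) = K.
  rewrite /K mul_col_mx !mulmxDr; congr col_mx.
    by rewrite !mulmxA Jn mul0mx addr0 mulmxV // mul1mx.
  by rewrite !mulmxA nJt !mul0mx add0r nnt mul1mx.
by rewrite -[LHS]mul1mx -(mulVmx K_unit) -mulmxA KP mulVmx.
Qed.

Lemma normal_colinear J n v : row_free J -> J *m n^T = 0 -> dot n n = 1 ->
  J *m v^T = 0 -> v = dot v n *: n.
Proof.
move=> J_free Jn nn Jv.
have vJ : v *m J^T = 0 by rewrite -[v *m _]trmxK trmx_mul trmxK Jv trmx0.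
have /(congr1 (mulmx v)) := tangent_projection J_free Jn nn.
rewrite mulmxBr mulmx1 !mulmxA vJ !mul0mx => /esym/subr0_eq {1}->.
by rewrite [v *m _]mx11_scalar -dotE mul_scalar_mx.
Qed.

(** When the differential of [xi] along the surface is the restriction of an
    ambient linear map [M], the projection [1 - n^T n] onto the tangent plane and
    the cyclicity of the trace remove the parametrization: the surface divergence
    is the full trace of [M] minus its normal contribution. *)
Lemma surface_div_ambient (X xi : 'rV[R]_2 -> 'rV[R]_3) (u : 'rV[R]_2) n (M : 'M[R]_3) :
  row_free ('J X u) -> unit_normal X u n -> 'J xi u = 'J X u *m M ->
  surface_div X xi u = \tr M - dot (n *m M) n.
Proof.
move=> J_free [n_unit n_normal] JM.
have Jn : 'J X u *m n^T = 0.
  apply/row_matrixP => i; rewrite row_mul row0; apply/matrixP => a b.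
  by rewrite !ord1 -dotE n_normal mxE.
have nn : dot n n = 1 by rewrite -enorm_sqr n_unit expr1n.
rewrite /surface_div /first_form JM -!mulmxA mxtrace_mulC -mulmxA.
rewrite (tangent_projection J_free Jn nn) mulmxBr mulmx1.
rewrite linearB /=; congr (_ - _).
by rewrite mulmxA mxtrace_mulC mulmxA [_ *m n^T]mx11_scalar mxtrace_scalar -dotE.
Qed.

End TangentPlane.

(** * Normals of a level set *)

Section Normals.
Variable R : realType.
Local Notation plane := 'rV[R]_2.
Local Notation space := 'rV[R]_3.

Lemma level_set_normal (U : set plane) (X : plane -> space) (F : space -> R)
    (N : space) u i :
  open U -> U u -> differentiable X u -> (forall v, U v -> F (X v) = 0) ->
  is_diff (X u) F (fun h => dot h N) -> dot (row i ('J X u)) N = 0.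
Proof.
move=> U_open Uu X_diff FX0 dF.
have XdX := differentiableP X_diff.
rewrite (jacobian_row _ XdX).
have FX_cst : {near u, cst 0 =1 F \o X}.
  by near=> v; rewrite /= FX0 //; near: v; exact: open_nbhs_nbhs.
have [_ dFX] := near_eq_is_diff FX_cst (is_diff_cst (0 : R) u).
have [_] := is_diff_comp XdX dF; rewrite dFX => /(congr1 (fun f => f (basis_vec R i))).
exact: esym.
Unshelve. all: by end_near. Qed.

Lemma continuous_dot (T : topologicalType) (f g : T -> space) x :
  {for x, continuous f} -> {for x, continuous g} ->
  {for x, continuous (fun y => dot (f y) (g y))}.
Proof.
have coord (h : T -> space) i : {for x, continuous h} ->
    {for x, continuous (fun y => h y 0 i : R)}.
  move=> h_cont; apply: (@continuous_comp _ _ _ h (fun w : space => w 0 i : R)) => //.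
  exact: coord_continuous.
move=> f_cont g_cont.
rewrite (_ : (fun y => _) =
  (fun y => f y 0 0 * g y 0 0 + f y 0 1 * g y 0 1 + f y 0 ord_max * g y 0 ord_max)).
  by apply: continuousD; [apply: continuousD|]; apply: continuousM; exact: coord.
by apply/funext => y; rewrite dot3.
Qed.

(** A nowhere zero normal field [N] is [c *: nu] with [c = <N, nu>] continuous and
    nonzero, so the sign of [c] is locally constant: near each point the
    orientation is a fixed choice of sign. *)
Lemma gauss_map_near_unit (U : set plane) (X nu N : plane -> space) u :
  immersed_surface U X -> gauss_map U X nu -> U u ->
  (forall v, U v -> N v != 0) ->
  (forall v, U v -> forall i, dot (row i ('J X v)) (N v) = 0) ->
  {for u, continuous N} ->
  exists2 e : R, e ^+ 2 = 1 & \forall v \near u, nu v = (e / enorm (N v)) *: N v.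
Proof.
move=> [U_open _ X_free] nu_gauss Uu N_neq0 N_normal N_cont.
pose c v := dot (N v) (nu v).
have Nc v : U v -> [/\ N v = c v *: nu v, c v != 0 & enorm (N v) = `|c v|].
  move=> Uv; have [[nu_unit nu_normal] _] := nu_gauss v Uv.
  have normalE (w : space) : (forall i, dot (row i ('J X v)) w = 0) -> 'J X v *m w^T = 0.
    move=> w_normal; apply/row_matrixP => i; rewrite row_mul row0; apply/matrixP => a b.
    by rewrite !ord1 -dotE w_normal mxE.
  have nu1 : dot (nu v) (nu v) = 1 by rewrite -enorm_sqr nu_unit expr1n.
  have NvE := normal_colinear (X_free v Uv) (normalE _ nu_normal) nu1
    (normalE _ (N_normal v Uv)).
  split=> //.
    by apply: contraNneq (N_neq0 v Uv) => c0; rewrite NvE -/(c v) c0 scale0r.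
  by rewrite /enorm {1 2}NvE dotZl dotZr nu1 mulr1 -/(c v) -expr2 sqrtr_sqr.
have c_cont : {for u, continuous c}.
  by apply: continuous_dot => //; have [] := nu_gauss u Uu.
have sg_near : \forall v \near u, Num.sg (c v) = Num.sg (c u).
  have [_ cu_neq0 _] := Nc u Uu; case: (ltgtP (c u) 0) cu_neq0 => // cu0 _.
    have : \forall v \near u, c v < 0 by exact: cvgr_lt c_cont _ cu0.
    by apply: filterS => v cv0; rewrite !ltr0_sg.
  have : \forall v \near u, 0 < c v by exact: cvgr_gt c_cont _ cu0.
  by apply: filterS => v cv0; rewrite !gtr0_sg.
exists (Num.sg (c u)); first by have [_ + _] := Nc u Uu; rewrite sqr_sg => ->.
near=> v.
have Uv : U v by near: v; exact: open_nbhs_nbhs.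
have [NvE cv_neq0 ->] := Nc v Uv.
have <- : Num.sg (c v) = Num.sg (c u) by near: v.
rewrite [in RHS]NvE scalerA.
have -> : Num.sg (c v) / `|c v| * c v = 1.
  by rewrite mulrAC -normrEsg divff // normr_eq0.
by rewrite scale1r.
Unshelve. all: by end_near. Qed.

End Normals.

(** * The Cahn-Hoffman map of an axially symmetric density *)

Section Profile.
Variable R : realType.
Local Notation space := 'rV[R]_3.
Implicit Types (gamma : space -> R) (g : R -> R) (Y : space).

Lemma is_diff_enorm Y : Y != 0 ->
  is_diff Y (@enorm R 3) (fun h => dot Y h / enorm Y).
Proof.
move=> Y_neq0.
have dd : is_diff Y (fun Z : space => dot Z Z) (fun h => 2 * dot Y h).
  have c i := is_diff_coord Y i.
  have := is_diffD (is_diffD (is_diffM (c 0) (c 0)) (is_diffM (c 1) (c 1)))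
    (is_diffM (c ord_max) (c ord_max)).
  rewrite (_ : _ + _ = (fun Z : space => dot Z Z)); last first.
    by apply/funext => Z; rewrite dot3.
  move=> /is_diff_eq; apply; apply/funext => h; rewrite dot3.
  by rewrite !fctE /= /GRing.scale /=; ring.
have dot_gt0 : 0 < dot Y Y by rewrite lt_def dot_eq0 Y_neq0 dot_ge0.
have e_gt0 : 0 < enorm Y by rewrite sqrtr_gt0.
have := is_diff_comp1 dd (is_derive1_sqrt dot_gt0).
move=> /is_diff_eq; apply; apply/funext => h.
by rewrite -/(enorm Y) /GRing.scale /=; field; rewrite gt_eqF.
Qed.

Lemma enorm_gt0 Y : Y != 0 -> 0 < enorm Y.
Proof. by move=> Y0; rewrite sqrtr_gt0 lt_def dot_eq0 Y0 dot_ge0. Qed.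

Lemma enormZ a Y : enorm (a *: Y) = `|a| * enorm Y.
Proof.
by rewrite /enorm dotZl dotZr mulrA -expr2 sqrtrM ?sqr_ge0 // sqrtr_sqr.
Qed.

Lemma enorm_neq0 Y : enorm Y != 0 -> Y != 0.
Proof.
by apply: contraNneq => ->; rewrite /enorm /dot big1 ?sqrtr0 // => i _; rewrite mxE mul0r.
Qed.

Lemma grad_is_diff (F : space -> R) (v : space) Y :
  is_diff Y F (dot v) -> grad F Y = v.
Proof.
case=> F_diff dF; apply/rowP => i; rewrite mxE deriveE // dF.
rewrite /dot /basis_vec (bigD1 i) //= big1 => [|j ji].
  by rewrite !mxE !eqxx mulr1 addr0.
rewrite !mxE.
by rewrite (negbTE ji) andbF mulr0.
Qed.

(** With [gamma n = g n_3] the extension is [|Y| g (Y_3 / |Y|)]; its gradient is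
    computed where [|Y| = 1]. Away from the poles the Cahn-Hoffman map is thus a
    combination of the normal and of the axis, with coefficients that are functions
    of [n_3]. *)
Lemma grad_homogeneous_ext gamma g Y :
  (forall n, sphere n -> gamma n = g (n 0 ord_max)) ->
  enorm Y = 1 -> derivable g (Y 0 ord_max) 1 ->
  grad (homogeneous_ext gamma) Y =
    (g (Y 0 ord_max) - Y 0 ord_max * 'D_1 g (Y 0 ord_max)) *: Y
    + 'D_1 g (Y 0 ord_max) *: basis_vec R ord_max.
Proof.
move=> gammaE Y1 g_der; apply: grad_is_diff; set s := Y 0 ord_max.
have Y_neq0 : Y != 0 by apply: enorm_neq0; rewrite Y1 oner_neq0.
have dn := is_diff_enorm Y_neq0.
have dV : is_derive (enorm Y) 1 GRing.inv (- (enorm Y) ^- 2 *: 1).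
  by apply: (@is_deriveV _ id); rewrite /= Y1 oner_neq0.
have dq := is_diffM (is_diff_coord Y ord_max) (is_diff_comp1 dn dV).
have q_s : ((fun Z : space => Z 0 ord_max : R) * (GRing.inv \o @enorm R 3)) Y = s.
  by rewrite fctE /= Y1 invr1 mulr1.
have dg : is_derive s 1 g ('D_1 g s) := derivableP g_der.
rewrite -[in is_derive s]q_s in dg.
have dH := is_diffM dn (is_diff_comp1 dq dg).
have nearE : {near Y, (@enorm R 3 * (g \o
    ((fun Z : space => Z 0 ord_max : R) * (GRing.inv \o @enorm R 3)))) =1
    homogeneous_ext gamma}.
  have : \forall Z \near Y, 0 < enorm Z.
    have n_cont : {for Y, continuous (@enorm R 3)}.
      by apply: differentiable_continuous; case: dn.
    exact: cvgr_gt n_cont _ (enorm_gt0 Y_neq0).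
  apply: filterS => Z Z_gt0; rewrite /homogeneous_ext gammaE; last first.
    by rewrite /sphere /= enormZ normfV ger0_norm ?ltW // mulVf // gt_eqF.
  by rewrite !fctE /= mxE mulrC [X in g X]mulrC mulrC.
have := near_eq_is_diff nearE dH; move=> /is_diff_eq; apply; apply/funext => h.
rewrite !fctE /= Y1 invr1 !expr1n !invr1.
have -> : dot ((g s - s * 'D_1 g s) *: Y + 'D_1 g s *: basis_vec R ord_max) h =
    (g s - s * 'D_1 g s) * dot Y h + 'D_1 g s * h 0 ord_max.
  rewrite !dot3 !mxE /=; ring.
by rewrite /GRing.scale /= -/s !mulr1; ring.
Qed.

End Profile.

Section ProfileRegularity.
Variable R : realType.
Local Notation space := 'rV[R]_3.
Implicit Types (gamma : space -> R) (g : R -> R) (s t : R).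

Definition meridian t : space := vec3 (Num.sqrt (1 - t ^+ 2)) 0 t.

Lemma is_derive_meridian_radius t : t ^+ 2 < 1 ->
  is_derive t 1 (fun x => Num.sqrt (1 - x ^+ 2)) (- t / Num.sqrt (1 - t ^+ 2)).
Proof.
move=> t1; have q_gt0 : 0 < 1 - t ^+ 2 by rewrite subr_gt0.
have dp : is_derive t 1 (fun x : R => 1 - x ^+ 2) (- (2 * t)).
  apply: is_derive_eq; rewrite /GRing.scale /=; ring.
have := @is_derive1_comp _ _ (fun x : R => 1 - x ^+ 2) _ _ _ (is_derive1_sqrt q_gt0) dp.
move=> /is_derive_eq; apply.
by field; rewrite gt_eqF // sqrtr_gt0.
Qed.

Lemma is_diff_meridian t : t ^+ 2 < 1 ->
  is_diff t meridian (fun h => h *: vec3 (- t / Num.sqrt (1 - t ^+ 2)) 0 1).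
Proof.
move=> t1; have dq := is_diff_comp1 (is_diff_id t) (is_derive_meridian_radius t1).
have := is_diff_vec3 dq (is_diff_cst 0 t) (is_diff_id t).
move=> /is_diff_eq; apply; apply/funext => h; apply/rowP => i; rewrite !mxE.
by case: i => -[|[|[|//]]] ? /=; rewrite /GRing.scale /= ?mulr0 ?mulr1.
Qed.

(** Along a meridian of the sphere [g] agrees with a smooth function on an open
    subset of space, so its regularity is that of the meridian, parametrized by
    height. Two derivatives are needed because [g'] enters the Cahn-Hoffman field,
    which is differentiated once more. The poles are excluded because [g] is
    arbitrary outside the heights of the sphere, so it need not be differentiable
    at the two extreme ones. *)
Lemma axial_profile_derivable2 gamma g s :
  smooth_on_sphere gamma ->
  (forall n, sphere n -> gamma n = g (n 0 ord_max)) -> s ^+ 2 < 1 ->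
  derivable g s 1 /\ derivable ('D_1 g) s 1.
Proof.
move=> gamma_smooth gammaE s1.
have on_sphere t : t ^+ 2 < 1 -> sphere (meridian t).
  move=> t1; rewrite /sphere /= /enorm dot3 !mxE /= -!expr2 sqr_sqrtr ?subr_ge0 ?ltW //.
  by rewrite (_ : _ + _ = 1) ?sqrtr1 //; ring.
have [V [F [V_open Vs F_smooth FE]]] := gamma_smooth _ (on_sphere s s1).
have F_diff p : V p -> differentiable F p by case: (F_smooth 1%N) => + _; exact.
have DF_diff v p : V p -> differentiable ('D_v F) p.
  by case: (F_smooth 2%N) => _ /(_ v)[+ _]; exact.
have near_s : \forall t \near s, t ^+ 2 < 1 /\ V (meridian t).
  have m_cont : {for s, continuous meridian}.
    by apply: differentiable_continuous; have [] := is_diff_meridian s1.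
  near=> t; split; near: t; last by apply: m_cont; exact: open_nbhs_nbhs.
  by apply: cvgr_lt s1; exact: exprn_continuous.
have gE : \forall t \near s, {near t, (F \o meridian) =1 g}.
  apply: near_join; apply: filterS near_s => t [t1 Vt].
  by rewrite /= FE ?gammaE ?mxE //; exact: on_sphere.
(* Stated at every nearby point, so that [g'] itself can be differentiated. *)
have Fm_diff t : t ^+ 2 < 1 -> V (meridian t) -> {near t, (F \o meridian) =1 g} ->
    is_derive t 1 g (- t / Num.sqrt (1 - t ^+ 2) * 'D_(basis_vec R 0) F (meridian t)
                     + 'D_(basis_vec R ord_max) F (meridian t)).
  move=> t1 Vt gFm.
  have [g_diff dg] := near_eq_is_diff gFm
    (is_diff_comp (is_diff_meridian t1) (differentiableP (F_diff _ Vt))).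
  split; first exact/derivable1_diffP.
  rewrite (deriveE _ g_diff) !(deriveE _ (F_diff _ Vt)) dg /= scale1r.
  have -> : vec3 (- t / Num.sqrt (1 - t ^+ 2)) 0 1 =
      (- t / Num.sqrt (1 - t ^+ 2)) *: basis_vec R 0 + basis_vec R ord_max :> space.
    apply/rowP => i; rewrite !mxE.
    by case: i => -[|[|[|//]]] ? /=; rewrite ?(mulr1, mulr0, addr0, add0r).
  by rewrite linearD linearZ.
have [s_near gs] : V (meridian s) /\ {near s, (F \o meridian) =1 g}.
  by split; [have [] := nbhs_singleton near_s|exact: nbhs_singleton gE].
split; first by have [] := Fm_diff s s1 s_near gs.
have g'E : {near s, (fun t => - t / Num.sqrt (1 - t ^+ 2) *
    'D_(basis_vec R 0) F (meridian t) + 'D_(basis_vec R ord_max) F (meridian t)) =1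
    'D_1 g}.
  near=> t.
  have [t1 Vt] : t ^+ 2 < 1 /\ V (meridian t) by near: t.
  have gt : {near t, (F \o meridian) =1 g} by near: t.
  by have [_ ->] := Fm_diff t t1 Vt gt.
apply: near_eq_derivable g'E _.
have m_diff : differentiable meridian s by have [] := is_diff_meridian s1.
have DFm v : derivable ('D_v F \o meridian) s 1.
  apply/derivable1_diffP; exact: (differentiable_comp m_diff (DF_diff v _ s_near)).
have [dq_der _] := is_derive_meridian_radius s1.
have q_neq0 : Num.sqrt (1 - s ^+ 2) != 0 by rewrite gt_eqF // sqrtr_gt0 subr_gt0.
have dN : derivable (fun t : R => - t) s 1 by exact: derivable_opp.
have dqV := derivableV (f := fun t => Num.sqrt (1 - t ^+ 2)) q_neq0 dq_der.
have dr := derivableM dN dqV.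
have dr0 := derivableM dr (DFm (basis_vec R 0)).
exact: derivableD dr0 (DFm (basis_vec R ord_max)).
Unshelve. all: by end_near. Qed.

End ProfileRegularity.

(** * The helicoid *)

Section Helicoid.
Variables (R : realType) (lambda C : R).
Local Notation space := 'rV[R]_3.
Implicit Types p h : space.

Definition helicoid_angle p : R := lambda^-1 * (p 0 ord_max - C).

Definition helicoid_eqn p : R :=
  p 0 0 * sin (helicoid_angle p) - p 0 1 * cos (helicoid_angle p).

(** This is [r / lambda], with [r] the signed distance to the axis along the
    ruling; it is also the vertical component of the normal whose horizontal part
    has length one. *)
Definition helicoid_slope p : R := lambda^-1 *
  (p 0 0 * cos (helicoid_angle p) + p 0 1 * sin (helicoid_angle p)).

(** With [D] the unit direction of the ruling at height [p_3] and [T] the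
    horizontal unit vector orthogonal to it, this is [a T + b e_3]. For [a = 1] and
    [b = id] it is the gradient of [helicoid_eqn], a normal field of the helicoid;
    other choices of [a] and [b] give the Cahn-Hoffman fields. *)
Definition helicoid_field (a b : R -> R) p : space :=
  vec3 (a (helicoid_slope p) * sin (helicoid_angle p))
    (- (a (helicoid_slope p) * cos (helicoid_angle p))) (b (helicoid_slope p)).

Lemma helicoid_eqn0 q : lambda != 0 -> helicoid_eqn (helicoid lambda C q) = 0.
Proof.
move=> lambda_neq0.
by rewrite /helicoid_eqn /helicoid_angle !mxE /= addrK mulKf //; ring.
Qed.

Lemma is_diff_helicoid_angle p :
  is_diff p helicoid_angle (fun h => lambda^-1 * h 0 ord_max).
Proof.
have := is_diffZ lambda^-1 (is_diffB (is_diff_coord p ord_max) (is_diff_cst C p)).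
by move=> /is_diff_eq; apply; apply/funext => h; rewrite !fctE subr0.
Qed.

Lemma is_diff_helicoid_eqn p :
  is_diff p helicoid_eqn (fun h => dot h (helicoid_field (cst 1) id p)).
Proof.
have dphi := is_diff_helicoid_angle p.
have dsin := is_diff_comp1 dphi (is_derive_sin _).
have dcos := is_diff_comp1 dphi (is_derive_cos _).
have := is_diffB (is_diffM (is_diff_coord p 0) dsin) (is_diffM (is_diff_coord p 1) dcos).
move=> /is_diff_eq; apply; apply/funext => h; rewrite dot3 !mxE /= !fctE.
by rewrite /helicoid_slope /GRing.scale /=; ring.
Qed.

(** Differentiating the angle contributes a multiple of [helicoid_eqn p], so on
    the helicoid the slope only varies in the direction of the ruling. *)
Lemma is_diff_helicoid_slope p : helicoid_eqn p = 0 ->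
  is_diff p helicoid_slope (fun h => lambda^-1 *
    (h 0 0 * cos (helicoid_angle p) + h 0 1 * sin (helicoid_angle p))).
Proof.
rewrite /helicoid_eqn => p0; have dphi := is_diff_helicoid_angle p.
have dsin := is_diff_comp1 dphi (is_derive_sin _).
have dcos := is_diff_comp1 dphi (is_derive_cos _).
have := is_diffZ lambda^-1
  (is_diffD (is_diffM (is_diff_coord p 0) dcos) (is_diffM (is_diff_coord p 1) dsin)).
move=> /is_diff_eq; apply; apply/funext => h; rewrite !fctE.
rewrite /GRing.scale /=; congr (_ * _).
(* The two sides differ by a multiple of [helicoid_eqn p]. *)
by rewrite -[RHS](subr0) -[in RHS](mulr0 (lambda^-1 * h 0 ord_max)) -[in RHS]p0; ring.
Qed.

(** The value of the first coefficient at [p] is [a0], and [a'], [b'] are the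
    derivatives of both. With [D] and [T] as for [helicoid_field], the matrix is
    that of [h |-> (<h, D> (a' T + b' e_3) + h_3 a0 D) / lambda]. *)
Definition helicoid_field_jacobian (a0 a' b' : R) p : 'M[R]_3 :=
  let S := sin (helicoid_angle p) in let K := cos (helicoid_angle p) in
  lambda^-1 *: \matrix_(i < 3)
    [:: vec3 (a' * K * S) (- (a' * K * K)) (b' * K);
        vec3 (a' * S * S) (- (a' * S * K)) (b' * S);
        vec3 (a0 * K) (a0 * S) 0]`_i.

Lemma is_diff_helicoid_field (a b : R -> R) (a' b' : R) p : helicoid_eqn p = 0 ->
  is_derive (helicoid_slope p) 1 a a' -> is_derive (helicoid_slope p) 1 b b' ->
  is_diff p (helicoid_field a b)
    (fun h => h *m helicoid_field_jacobian (a (helicoid_slope p)) a' b' p).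
Proof.
move=> p0 da db; have dphi := is_diff_helicoid_angle p.
have dsin := is_diff_comp1 dphi (is_derive_sin _).
have dcos := is_diff_comp1 dphi (is_derive_cos _).
have dslope := is_diff_helicoid_slope p0.
have := is_diff_vec3 (is_diffM (is_diff_comp1 dslope da) dsin)
  (is_diffN (is_diffM (is_diff_comp1 dslope da) dcos)) (is_diff_comp1 dslope db).
move=> /is_diff_eq; apply; apply/funext => h; apply/rowP => j.
have hME (M : 'M[R]_3) : (h *m M) 0 j =
    h 0 0 * M 0 j + h 0 1 * M 1 j + h 0 ord_max * M ord_max j.
  rewrite mxE !big_ord_recl big_ord0 addr0 addrA.
  by do ![congr (_ + _)|congr (_ * _)|congr (fun_of_matrix _ _ _)|apply/val_inj].
rewrite hME !mxE.
by case: j {hME} => -[|[|[|//]]] ? /=; rewrite ?mxE /= ?fctE /GRing.scale /=; ring.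
Qed.

(** The cancellation behind the theorem. The trace is
    [<D, a' T + b' e_3> + <e_3, a0 D>] up to the factor [1 / lambda], and the normal
    [T + t e_3], with [t] the slope, is mapped to a multiple of [D]: both terms
    vanish because the ruling is orthogonal to [T] and [e_3]. *)
Lemma helicoid_field_jacobian_trace a0 a' b' p k :
  let M := helicoid_field_jacobian a0 a' b' p in
  let N := k *: helicoid_field (cst 1) id p in
  \tr M - dot (N *m M) N = 0.
Proof.
move=> M N.
have -> : \tr M = 0.
  by rewrite /M /mxtrace !big_ord_recl big_ord0 !mxE /= ?mxE /=; ring.
rewrite sub0r /N -scalemxAl dotZl dotZr.
suff -> : dot (helicoid_field (cst 1) id p *m M) (helicoid_field (cst 1) id p) = 0.
  by rewrite !mulr0 oppr0.
by rewrite dot3 !mxE !big_ord_recl !big_ord0 /= ?mxE /= ?mxE /=; ring.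
Qed.

End Helicoid.

Section CahnHoffman.
Variable R : realType.
Local Notation space := 'rV[R]_3.

(** The unit normal is [sigma t (T + t e_3)] with [sigma t = e / sqrt (1 + t^2)],
    so its height [s t] and the coefficients of the Cahn-Hoffman map are functions
    of the slope [t] alone. As [|s t| < 1] the normal is never vertical, and the
    profile can be differentiated twice there. *)
Lemma cahn_hoffman_helicoid_field (gamma : space -> R) (g : R -> R) lambda C
    (e t0 : R) :
  smooth_on_sphere gamma ->
  (forall n, sphere n -> gamma n = g (n 0 ord_max)) -> e ^+ 2 = 1 ->
  exists a b : R -> R, [/\ derivable a t0 1, derivable b t0 1 &
    forall p, let N := helicoid_field lambda C (cst 1) id p in
      grad (homogeneous_ext gamma) ((e / enorm N) *: N) =
        helicoid_field lambda C a b p].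
Proof.
move=> gamma_smooth gammaE e1.
pose sigma (t : R) := e * (Num.sqrt (1 + t ^+ 2))^-1.
have w_gt0 (t : R) : 0 < 1 + t ^+ 2 by rewrite ltr_wpDr ?sqr_ge0.
have sqrt_neq0 (t : R) : Num.sqrt (1 + t ^+ 2) != 0 by rewrite gt_eqF // sqrtr_gt0.
have sigmaE t : sigma t ^+ 2 * (1 + t ^+ 2) = 1.
  rewrite /sigma exprMn e1 exprVn sqr_sqrtr ?ltW //.
  by rewrite mul1r mulVf // gt_eqF.
pose s (t : R) := sigma t * t.
have s_lt1 t : s t ^+ 2 < 1.
  have : 0 < sigma t ^+ 2.
    rewrite lt_def sqr_ge0 andbT; apply/eqP => sigma0.
    by have /eqP := sigmaE t; rewrite sigma0 mul0r eq_sym oner_eq0.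
  have -> : s t ^+ 2 = 1 - sigma t ^+ 2 by rewrite -(sigmaE t) /s; ring.
  by rewrite ltrBlDr ltrDl.
have g_diff t : derivable g (s t) 1 /\ derivable ('D_1 g) (s t) 1.
  exact: axial_profile_derivable2 gamma_smooth gammaE (s_lt1 t).
pose A (t : R) := g (s t) - s t * 'D_1 g (s t).
exists (fun t => A t * sigma t), (fun t => A t * s t + 'D_1 g (s t)).
have dsigma : derivable sigma t0 1.
  have dw : derivable (fun t : R => 1 + t ^+ 2) t0 1.
    by apply: derivableD => //; exact: exprn_derivable.
  have [dsq _] := is_derive1_sqrt (w_gt0 t0).
  have dsqrt := derivable_comp1 (g := fun t : R => 1 + t ^+ 2) dw dsq.
  exact: derivableM (derivable_cst e t0 1)
    (derivableV (f := fun t : R => Num.sqrt (1 + t ^+ 2)) (sqrt_neq0 t0) dsqrt).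
have ds : derivable s t0 1 := derivableM dsigma (@derivable_id _ _ t0 1).
have ds_comp (f : R -> R) : derivable f (s t0) 1 -> derivable (f \o s) t0 1.
  exact: derivable_comp1.
have [dg dg'] := g_diff t0.
have dA : derivable A t0 1.
  exact: (derivableB (ds_comp _ dg) (derivableM ds (ds_comp _ dg'))).
split.
- exact: derivableM dA dsigma.
- exact: (derivableD (derivableM dA ds) (ds_comp _ dg')).
move=> p N; set t := helicoid_slope lambda C p.
have NN : dot N N = 1 + t ^+ 2.
  rewrite dot3 !mxE /= !mul1r -/t mulrNN -!expr2.
  by rewrite [X in X + _ = _]addrC cos2Dsin2.
have enN : enorm N = Num.sqrt (1 + t ^+ 2) by rewrite /enorm NN.
rewrite enN -/(sigma t).
have N3 : (sigma t *: N) 0 ord_max = s t by rewrite !mxE.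
rewrite (grad_homogeneous_ext gammaE); rewrite ?N3.
- apply/rowP => i; rewrite !mxE -/t.
  by case: i => -[|[|[|//]]] ? /=; rewrite /A /s /=; ring.
- by rewrite /enorm dotZl dotZr NN mulrA -expr2 sigmaE sqrtr1.
- by have [] := g_diff t.
Qed.

End CahnHoffman.

(* The helicoid is the image of [helicoid lambda C]; the conclusion is about every
   immersed piece (U, X) of it, with either orientation. X can be
   [helicoid lambda C] itself wherever that map is an immersion (that is, unless
   lambda = r = 0); other X are only needed for the centre of the plane
   lambda = 0, where polar coordinates are singular. *)
Theorem proposition2p1 (R : realType) (gamma : 'rV[R]_3 -> R)
  (gamma_density : anisotropic_energy_density gamma)
  (gamma_axial : axially_symmetric gamma)
  (lambda C : R)
  (U : set 'rV[R]_2) (X nu : 'rV[R]_2 -> 'rV[R]_3)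
  (X_immersed : immersed_surface U X)
  (X_helicoid : X @` U `<=` range (helicoid lambda C))
  (nu_gauss : gauss_map U X nu) :
  forall u, U u -> aniso_mean_curvature gamma X nu u = 0.
Proof.
move=> u Uu; have [U_open X_smooth X_free] := X_immersed.
have [gamma_smooth _ _ _ _] := gamma_density; have [g gammaE] := gamma_axial.
have X_diff v : U v -> differentiable X v by case: (X_smooth 1%N) => + _; exact.
have nu_unit : unit_normal X u (nu u) by have [] := nu_gauss u Uu.
apply/eqP; rewrite oppr_eq0; apply/eqP.
(* When [lambda = 0] the surface is a horizontal plane: its normal points to a pole,
   where [g] need not be differentiable, its values outside the heights of the
   sphere being arbitrary; but it is locally constant and so is the Cahn-Hoffman
   field. *)
have [lambda0|lambda_neq0] := eqVneq lambda 0.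
  pose N : 'rV[R]_3 := basis_vec R ord_max.
  have N_normal v : U v -> forall i, dot (row i ('J X v)) N = 0.
    move=> Uv i; pose F (p : 'rV[R]_3) := p 0 ord_max - C.
    apply: (level_set_normal (F := F) i U_open Uv (X_diff v Uv)).
      move=> w Uw; have [q _ <-] := X_helicoid (X w) (ex_intro2 _ _ w Uw erefl).
      by rewrite /F mxE /= lambda0 mul0r add0r subrr.
    have := is_diffB (is_diff_coord (X v) ord_max) (is_diff_cst C (X v)).
    move=> /is_diff_eq; apply; apply/funext => h.
    by rewrite !fctE dot3 !mxE /= subr0 !mulr0 !add0r mulr1.
  have N_neq0 v : U v -> N != 0.
    move=> _; apply: contra_neq (oner_neq0 R) => /rowP/(_ ord_max).
    by rewrite !mxE !eqxx.
  have [e _ nuE] := gauss_map_near_unit X_immersed nu_gauss Uu N_neq0 N_normal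
    (@cst_continuous _ _ N u).
  rewrite (surface_div_ambient (n := nu u) (M := 0)) ?mulmx0 //.
  - by rewrite mxtrace0 /dot big1 ?subr0 // => i _; rewrite mxE mul0r.
  - exact: X_free.
  apply: (@jacobian_near_cst _ _ _ _ _
    (grad (homogeneous_ext gamma) ((e / enorm N) *: N))).
  by apply: filterS nuE => v; rewrite /cahn_hoffman => ->.
have X_eqn v : U v -> helicoid_eqn lambda C (X v) = 0.
  move=> Uv; have [q _ <-] := X_helicoid (X v) (ex_intro2 _ _ v Uv erefl).
  exact: helicoid_eqn0.
pose N v := helicoid_field lambda C (cst 1) id (X v).
have N_normal v : U v -> forall i, dot (row i ('J X v)) (N v) = 0.
  move=> Uv i; apply: (level_set_normal i U_open Uv (X_diff v Uv) X_eqn).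
  exact: is_diff_helicoid_eqn.
have N_neq0 v : U v -> N v != 0.
  move=> _; apply: contra_neq (oner_neq0 R) => N0.
  rewrite -(cos2Dsin2 (helicoid_angle lambda C (X v))).
  move/rowP : N0 => N0; move: (N0 0) (N0 1); rewrite !mxE /= !mul1r.
  by move=> -> /eqP; rewrite oppr_eq0 => /eqP ->; rewrite !expr0n addr0.
have N_cont : {for u, continuous N}.
  apply: differentiable_continuous.
  apply: (differentiable_comp (X_diff u Uu)).
  by have [] := is_diff_helicoid_field (X_eqn u Uu)
    (@is_derive_cst _ _ _ (1 : R) _ _) (@is_derive_id _ _ _ _).
have [e e1 nuE] := gauss_map_near_unit X_immersed nu_gauss Uu N_neq0 N_normal N_cont.
have [a [b [da db xiE]]] := cahn_hoffman_helicoid_field lambda C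
  (helicoid_slope lambda C (X u)) gamma_smooth gammaE e1.
have dXi := is_diff_helicoid_field (X_eqn u Uu) (derivableP da) (derivableP db).
rewrite (surface_div_ambient (X_free u Uu) nu_unit
  (M := helicoid_field_jacobian lambda C (a (helicoid_slope lambda C (X u)))
    ('D_1 a (helicoid_slope lambda C (X u)))
    ('D_1 b (helicoid_slope lambda C (X u))) (X u))).
  by rewrite (nbhs_singleton nuE); exact: helicoid_field_jacobian_trace.
apply: jacobian_is_diff.
apply: near_eq_is_diff (is_diff_comp (differentiableP (X_diff u Uu)) dXi).
by apply: filterS nuE => v nuv; rewrite /cahn_hoffman nuv xiE.
Qed.
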